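(* Let $T>0$, $n\ge1$. Let $H_i$ ($i\in\mathbb{N}$) and $H$ be functions $[0,T]\times\mathbb{R}^n\times\mathbb{R}^n\to\mathbb{R}$, let $c_i,c:[0,T]\to[0,+\infty)$ and $\lambda_i,\lambda:[0,T]\times\mathbb{R}^n\to\mathbb{R}$, and suppose that each of the triples $(H_i,c_i,\lambda_i)$, $i\in\mathbb{N}$, and $(H,c,\lambda)$ is admissible in the sense of the context. Let $(f_i,l_i)$ be the pair canonically associated with $(H_i,c_i,\lambda_i)$ and $(f,l)$ the pair canonically associated with $(H,c,\lambda)$, as defined in the context. If for all $t\in[0,T]$ the functions $H_i(t,\cdot,\cdot)$ and $\lambda_i(t,\cdot)$ converge uniformly on compact sets to $H(t,\cdot,\cdot)$ and $\lambda(t,\cdot)$, respectively, and $c_i(t)\to c(t)$, then for all $t\in[0,T]$ the functions $f_i(t,\cdot,\cdot)$ converge to $f(t,\cdot,\cdot)$ and $l_i(t,\cdot,\cdot)$ converge to $l(t,\cdot,\cdot)$ uniformly on compact subsets of $\mathbb{R}^n\times\mathbb{B}$, where $\mathbb{B}$ is the closed unit ball of $\mathbb{R}^{n+1}$.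
   Context: $\mathbb{B}_R$ is the closed ball of radius $R$ about $0$ in $\mathbb{R}^n$; ''measurable'' means Lebesgue measurable; $\operatorname{dom}\varphi=\{x:\varphi(x)\ne\pm\infty\}$. Admissible triple. A triple $(H,c,\lambda)$, with $L(t,x,v):=\sup_{p\in\mathbb{R}^n}\{\langle v,p\rangle-H(t,x,p)\}$, is called admissible if: (1) $H(\cdot,x,p)$ is measurable for all $x,p$; $H(t,\cdot,\cdot)$ is continuous for all $t$; $H(t,x,\cdot)$ is convex for all $(t,x)$. (2) $c$ is measurable and $|H(t,x,p)-H(t,x,q)|\le c(t)(1+|x|)|p-q|$ for all $t\in[0,T]$, $x,p,q\in\mathbb{R}^n$. (3) For every $R>0$ there is a measurable $k_R:[0,T]\to[0,+\infty)$ with $|H(t,x,p)-H(t,y,p)|\le k_R(t)(1+|p|)|x-y|$ for all $t\in[0,T]$, $x,y\in\mathbb{B}_R$, $p\in\mathbb{R}^n$. (4) $\lambda$ is measurable in $t$ and continuous in $x$, $L(t,x,v)\le\lambda(t,x)$ for all $(t,x)$ and $v\in\operatorname{dom}L(t,x,\cdot)$, and for every $R>0$ there is a measurable $k_R:[0,T]\to[0,+\infty)$ such that $\lambda(t,\cdot)$ is $k_R(t)$-Lipschitz on $\mathbb{B}_R$ for every $t$. Canonical pair. For an admissible triple put $E_L(t,x):=\{(v,\eta)\in\mathbb{R}^n\times\mathbb{R}: L(t,x,v)\le\eta\}$ (a nonempty closed convex subset of $\mathbb{R}^{n+1}$), $\omega(t,x):=|\lambda(t,x)|+|H(t,x,0)|+c(t)(1+|x|)+1$,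 and, for $a\in\mathbb{R}^{n+1}$, $$\Phi(t,x,a):=E_L(t,x)\cap \mathbb{B}\big(\omega(t,x)a,\,2d(\omega(t,x)a,E_L(t,x))\big),\qquad \mathsf{e}(t,x,a):=s_{n+1}(\Phi(t,x,a)),$$ where $\mathbb{B}(y,r)$ is the closed ball of centre $y$ and radius $r$ in $\mathbb{R}^{n+1}$, $d(y,K)=\inf_{z\in K}|y-z|$, and $s_m(K)$ is the Steiner point of a nonempty compact convex $K\subset\mathbb{R}^m$ ($m\geq 2$): $s_m(K)=m\int_{S^{m-1}}p\,\sigma(K,p)\,\mu(dp)$, with $\sigma(K,p)=\max_{x\in K}\langle p,x\rangle$ and $\mu$ the normalized ($\mu(S^{m-1})=1$) Lebesgue surface measure on the unit sphere $S^{m-1}$. The canonical pair $(f,l)$ is given by $\mathsf{e}(t,x,a)=(f(t,x,a),l(t,x,a))\in\mathbb{R}^n\times\mathbb{R}$ for $a\in\mathbb{B}$ (closed unit ball of $\mathbb{R}^{n+1}$). It satisfies $H(t,x,p)=\sup_{a\in\mathbb{B}}\{\langle p,f(t,x,a)\rangle-l(t,x,a)\}$. *)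

(* Defs.v *)
From HB Require Import structures.
From mathcomp Require Import all_boot all_order all_algebra.
From mathcomp Require Import all_classical all_reals all_analysis.
From mathcomp Require Import measurable_realfun.

Set Implicit Arguments.
Unset Strict Implicit.
Unset Printing Implicit Defensive.
Import Order.TTheory GRing.Theory Num.Theory.
Import numFieldNormedType.Exports.

Local Open Scope classical_set_scope.
Local Open Scope ring_scope.

(* [measurable] on R is Borel measurability; the domain is therefore equipped
   here with the completed sigma-algebra. *)
Definition lebesgue_measurable_fun (R : realType) (D : set R) (g : R -> R) :=
  measurable_fun
    (D : set (g_sigma_algebraType (completed_algebra_gen (@lebesgue_measure R))))
    (g : _ -> measurableTypeR R).

(* The library norm on 'rV[R]_m is the sup norm, hence the following. *)
Section euclidean.
Context {R : realType} {m : nat}.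
Implicit Types (x y : 'rV[R]_m) (K : set 'rV[R]_m).

Definition dotp x y : R := \sum_i x 0 i * y 0 i.

Definition enorm x : R := Num.sqrt (dotp x x).

Definition eball y (r : R) : set 'rV[R]_m := [set z | enorm (z - y) <= r].

Definition edist y K : R := inf [set enorm (y - z) | z in K].

Definition esphere : set 'rV[R]_m := [set z | enorm z = 1].

(* The supremum is a maximum when K is nonempty and compact. *)
Definition support_fun K (p : 'rV[R]_m) : R := sup [set dotp p x | x in K].

End euclidean.

(* Borel sigma-algebra of R^m, generated by the coordinates *)
Definition rV_display : measure_display. Proof. exact. Qed.

Section rV_measurable.
Context {R : realType} {m : nat}.

Let coord (i : 'I_m) (x : 'rV[R]_m) : measurableTypeR R := x 0 i.

Let rV_set0 : g_sigma_preimage coord set0.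
Proof. exact: sigma_algebra0. Qed.

Let rV_setC A : g_sigma_preimage coord A -> g_sigma_preimage coord (~` A).
Proof. exact: sigma_algebraC. Qed.

Let rV_bigcup (F : _^nat) : (forall i, g_sigma_preimage coord (F i)) ->
  g_sigma_preimage coord (\bigcup_i (F i)).
Proof. exact: sigma_algebra_bigcup. Qed.

HB.instance Definition _ := @isMeasurable.Build rV_display
  'rV[R]_m (g_sigma_preimage coord) rV_set0 rV_setC rV_bigcup.

End rV_measurable.

Definition rV_cons (R : realType) (m : nat) (u : measurableTypeR R * 'rV[R]_m) :
  'rV[R]_m.+1 := row_mx (u.1%:M : 'rV[R]_1) u.2.

Fixpoint lebesgue_rV (R : realType) (m : nat) : set 'rV[R]_m -> \bar R :=
  match m with
  | 0 => \d_(0 : 'rV[R]_0)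
  | k.+1 => pushforward (@lebesgue_measure R \x @lebesgue_rV R k)%E (@rV_cons R k)
  end.

Section lebesgue_rV_measure.
Context {R : realType}.

Lemma measurable_coord (m : nat) (i : 'I_m) :
  measurable_fun setT (fun x : 'rV[R]_m => x 0 i : measurableTypeR R).
Proof.
move=> _ Y mY; rewrite setTI; apply: sub_sigma_algebra => /=.
rewrite -bigcup_seq/=; exists i => /=; first by rewrite mem_index_enum.
by exists Y => //; rewrite setTI.
Qed.

Lemma measurable_fun_rV d (S : measurableType d) (m : nat) (f : S -> 'rV[R]_m) :
  (forall i, measurable_fun setT (fun s => f s 0 i : measurableTypeR R)) ->
  measurable_fun setT f.
Proof.
move=> mf _ A; rewrite setTI => mA.
have : preimage_set_system setT f measurable `<=` @measurable _ S.
  change (@measurable _ 'rV[R]_m) with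
    (g_sigma_preimage (fun i (x : 'rV[R]_m) => x 0 i : measurableTypeR R)).
  rewrite -g_sigma_preimage_comp.
  apply: smallest_sub; first exact: sigma_algebra_measurable.
  case: m f mf {A mA} => [|m] f mf; first by rewrite big_ord0.
  rewrite -bigcup_mkord_ord; apply: bigcup_sub => i Ii.
  by move=> A [B mB <-]; exact: mf.
by apply; exists A => //; rewrite setTI.
Qed.

Lemma measurable_rV_cons (m : nat) : measurable_fun setT (@rV_cons R m).
Proof.
apply: measurable_fun_rV => i; case: (split_ordP (i : 'I_(1 + m))) => j ->.
- rewrite (_ : (fun _ => _) = fst) ?funeqE//= => s.
  by rewrite (row_mxEl (s.1%:M) s.2) mxE ord1 eqxx mulr1n.
- rewrite (_ : (fun _ => _) =
      (fun x : 'rV[R]_m => x 0 j : measurableTypeR R) \o snd).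
    by apply: measurableT_comp => //; exact: measurable_coord.
  by apply/funext => s /=; rewrite (row_mxEr (s.1%:M) s.2).
Qed.

Let rV_uncons (m : nat) (x : 'rV[R]_m.+1) : measurableTypeR R * 'rV[R]_m :=
  (x 0 0, rsubmx (x : 'rV[R]_(1 + m))).

Let rV_consK m : cancel (@rV_cons R m) (@rV_uncons m).
Proof.
move=> [a x]; rewrite /rV_uncons /rV_cons row_mxKr; congr pair => /=.
have -> : 0 = lshift m (0 : 'I_1) by exact/val_inj.
by rewrite (row_mxEl (a%:M) x) mxE eqxx mulr1n.
Qed.

Let measurable_rV_uncons m : measurable_fun setT (@rV_uncons m).
Proof.
apply/measurable_fun_pair => /=; first exact: measurable_coord.
apply: measurable_fun_rV => i; under eq_fun do rewrite mxE.
exact: measurable_coord.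
Qed.

Let lebesgue_rV_bundle m : exists mu : {sigma_finite_measure set 'rV[R]_m -> \bar R},
  mu = @lebesgue_rV R m :> (set 'rV[R]_m -> \bar R).
Proof.
elim: m => [|m [mu muE]]; first by exists (\d_(0 : 'rV[R]_0)).
pose prod := (@lebesgue_measure R \x mu)%E.
have mcons := @measurable_rV_cons m.
pose nu := @lebesgue_rV R m.+1.
have nuE : nu = pushforward prod (@rV_cons R m) by rewrite /nu /= -muE.
have nu0 : nu set0 = 0%E by rewrite nuE; exact: (measure0 (pushforward prod _)).
have nu_ge0 A : (0 <= nu A)%E.
  by rewrite nuE; exact: (measure_ge0 (pushforward prod _)).
have nu_sigma : semi_sigma_additive nu.
  by rewrite nuE; exact: (@measure_semi_sigma_additive _ _ _ (pushforward prod _)).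
have nu_sfin : sigma_finite setT nu.
  have /sigma_finiteP[F [TF ndF Foo]] := sigma_finiteT (@lebesgue_measure R).
  have /sigma_finiteP[G [TG ndG Goo]] := sigma_finiteT mu.
  exists (fun k => @rV_uncons m @^-1` (F k `*` G k)).
    rewrite -preimage_bigcup (_ : \bigcup_k _ = setT) ?preimage_setT//.
    rewrite -subTset => -[a x] _.
    have [i _ Fa] : (\bigcup_i F i) a by rewrite -TF.
    have [j _ Gx] : (\bigcup_i G i) x by rewrite -TG.
    exists (maxn i j) => //; split => /=.
    - by move: a Fa; exact/subsetPset/ndF/leq_maxl.
    - by move: x Gx; exact/subsetPset/ndG/leq_maxr.
  move=> k; have [mF Fk] := Foo k; have [mG Gk] := Goo k; split.
    rewrite -[X in measurable X]setTI.
    by apply: measurable_rV_uncons => //; exact: measurableX.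
  rewrite nuE /pushforward -comp_preimage.
  rewrite (_ : _ \o _ = id); last by apply/funext; exact: rV_consK.
  rewrite preimage_id /prod product_measure1E//.
  by rewrite lte_mul_pinfty// ge0_fin_numE.
pose nuM := isMeasure.Build _ _ _ nu nu0 nu_ge0 nu_sigma.
pose nuF := Measure_isSigmaFinite.Build _ _ _ (HB.pack nu nuM : {measure set _ -> \bar R}) nu_sfin.
pose nu' : {sigma_finite_measure set 'rV[R]_m.+1 -> \bar R} := HB.pack nu nuM nuF.
by exists nu'.
Qed.

Let lebesgue_rV0 m : @lebesgue_rV R m set0 = 0%E.
Proof. by have [mu <-] := lebesgue_rV_bundle m; exact: measure0. Qed.

Let lebesgue_rV_ge0 m A : (0 <= @lebesgue_rV R m A)%E.
Proof. by have [mu <-] := lebesgue_rV_bundle m; exact: measure_ge0. Qed.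

Let lebesgue_rV_sigma_additive m : semi_sigma_additive (@lebesgue_rV R m).
Proof.
by have [mu <-] := lebesgue_rV_bundle m; exact: measure_semi_sigma_additive.
Qed.

HB.instance Definition _ m := isMeasure.Build _ _ _ (@lebesgue_rV R m)
  (lebesgue_rV0 m) (@lebesgue_rV_ge0 m) (@lebesgue_rV_sigma_additive m).

Let lebesgue_rV_sigma_finite m : sigma_finite setT (@lebesgue_rV R m).
Proof. by have [mu <-] := lebesgue_rV_bundle m; exact: sigma_finiteT. Qed.

HB.instance Definition _ m := Measure_isSigmaFinite.Build _ _ _
  (@lebesgue_rV R m) (lebesgue_rV_sigma_finite m).

End lebesgue_rV_measure.

(* Normalized surface measure of the unit sphere, in polar coordinates: the
   measure of A is the proportion of the unit ball filled by the cone
   {x : x / |x| \in A}. *)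
Definition sphere_measure (R : realType) (m : nat) (A : set 'rV[R]_m) : \bar R :=
  (((fine (lebesgue_rV (eball (0 : 'rV[R]_m) 1)))^-1)%:E *
   lebesgue_rV [set x : 'rV[R]_m | eball 0 1 x /\ A ((enorm x)^-1 *: x)])%E.

Section sphere_measure_measure.
Context {R : realType} {m : nat}.

Let measurable_enorm :
  measurable_fun setT (@enorm R m : 'rV[R]_m -> measurableTypeR R).
Proof.
have msqrt : measurable_fun [set: R] (@Num.sqrt R).
  apply: continuous_measurable_fun; exact: sqrt_continuous.
apply: (measurableT_comp msqrt).
by apply: measurable_sum => i; apply: measurable_funM; exact: measurable_coord.
Qed.

Let measurable_eball : measurable (eball (0 : 'rV[R]_m) 1).
Proof.
rewrite (_ : eball _ _ = @enorm R m @^-1` `]-oo, 1]); last first.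
  by apply/seteqP; split => x; rewrite /eball /= in_itv /= subr0.
by rewrite -[X in measurable X]setTI; exact: measurable_enorm.
Qed.

Let direction (x : 'rV[R]_m) : 'rV[R]_m := (enorm x)^-1 *: x.

Let measurable_direction : measurable_fun setT direction.
Proof.
apply: measurable_fun_rV => i; under eq_fun do rewrite mxE.
apply: measurable_funM; last exact: measurable_coord.
under eq_fun do rewrite -powR_inv1 ?sqrtr_ge0//.
have mpow := @measurable_powR R (-1).
exact: (measurableT_comp mpow measurable_enorm).
Qed.

Let lebesgue_ball_ge0 : 0 <= (fine (lebesgue_rV (eball (0 : 'rV[R]_m) 1)))^-1.
Proof. by rewrite invr_ge0 fine_ge0. Qed.

Let sphere_measure_bundle : exists mu : {measure set 'rV[R]_m -> \bar R},
  mu = @sphere_measure R m :> (set 'rV[R]_m -> \bar R).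
Proof.
have mdir := measurable_direction.
have [nu nuE] : exists nu : {measure set 'rV[R]_m -> \bar R}, nu =
    pushforward (mrestr (@lebesgue_rV R m) measurable_eball) direction
    :> (set 'rV[R]_m -> \bar R).
  unshelve eexists
    (pushforward (mrestr (@lebesgue_rV R m) measurable_eball) direction) => //.
exists (mscale (NngNum lebesgue_ball_ge0) nu).
apply/funext => A; rewrite /= /mscale nuE /pushforward /mrestr /=.
by congr (_ * lebesgue_rV _)%E; rewrite setIC.
Qed.

Let sphere_measure0 : @sphere_measure R m set0 = 0%E.
Proof. by have [mu <-] := sphere_measure_bundle; exact: measure0. Qed.

Let sphere_measure_ge0 A : (0 <= @sphere_measure R m A)%E.
Proof. by have [mu <-] := sphere_measure_bundle; exact: measure_ge0. Qed.

Let sphere_measure_sigma_additive : semi_sigma_additive (@sphere_measure R m).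
Proof.
by have [mu <-] := sphere_measure_bundle; exact: measure_semi_sigma_additive.
Qed.

HB.instance Definition _ := isMeasure.Build _ _ _ (@sphere_measure R m)
  sphere_measure0 sphere_measure_ge0 sphere_measure_sigma_additive.

End sphere_measure_measure.

Definition steiner (R : realType) (m : nat) (K : set 'rV[R]_m) : 'rV[R]_m :=
  \row_j (m%:R *
    \int[@sphere_measure R m]_(p in esphere) (p 0 j * support_fun K p)).

Section canonical_pair.
Context {R : realType} {n : nat}.
Variables (H : R -> 'rV[R]_n -> 'rV[R]_n -> R) (c : R -> R)
  (lam : R -> 'rV[R]_n -> R).
Implicit Types (t : R) (x v : 'rV[R]_n) (a : 'rV[R]_(n + 1)).

Definition lagrangian t x v : \bar R :=
  ereal_sup [set (dotp v p - H t x p)%:E | p in [set: 'rV[R]_n]].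

(* A pair (v, eta) of R^n x R is the row vector row_mx v eta%:M. *)
Definition epi_lagrangian t x : set 'rV[R]_(n + 1) :=
  [set z | (lagrangian t x (lsubmx z) <= (rsubmx z 0 0)%:E)%E].

Definition omega t x : R :=
  `|lam t x| + `|H t x 0| + c t * (1 + enorm x) + 1.

Definition Phi t x a : set 'rV[R]_(n + 1) :=
  epi_lagrangian t x `&`
  eball (omega t x *: a) (2 * edist (omega t x *: a) (epi_lagrangian t x)).

Definition canonical_e t x a : 'rV[R]_(n + 1) := steiner (Phi t x a).

Definition canonical_f t x a : 'rV[R]_n := lsubmx (canonical_e t x a).

Definition canonical_l t x a : R := rsubmx (canonical_e t x a) 0 0.

Record admissible (T : R) : Prop := {
  adm_H_measurable : forall x p,
    lebesgue_measurable_fun `[0, T] (fun t => H t x p) ;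
  adm_H_continuous : forall t, 0 <= t <= T ->
    continuous (fun xp : 'rV[R]_n * 'rV[R]_n => H t xp.1 xp.2) ;
  adm_H_convex : forall t x, 0 <= t <= T ->
    convex_function (setT : set (convex_lmodType 'rV[R]_n)) (H t x) ;
  adm_c_ge0 : forall t, 0 <= t <= T -> 0 <= c t ;
  adm_c_measurable : lebesgue_measurable_fun `[0, T] c ;
  adm_H_lip_p : forall t x p q, 0 <= t <= T ->
    `|H t x p - H t x q| <= c t * (1 + enorm x) * enorm (p - q) ;
  adm_H_lip_x : forall r : R, 0 < r -> exists k : R -> R,
    [/\ lebesgue_measurable_fun `[0, T] k,
        forall t, 0 <= t <= T -> 0 <= k t &
        forall t x y p, 0 <= t <= T -> eball 0 r x -> eball 0 r y ->
          `|H t x p - H t y p| <= k t * (1 + enorm p) * enorm (x - y)] ;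
  adm_lam_measurable : forall x, lebesgue_measurable_fun `[0, T] (lam ^~ x) ;
  adm_lam_continuous : forall t, 0 <= t <= T -> continuous (lam t) ;
  adm_lam_bound : forall t x v, 0 <= t <= T ->
    lagrangian t x v \is a fin_num -> (lagrangian t x v <= (lam t x)%:E)%E ;
  adm_lam_lip : forall r : R, 0 < r -> exists k : R -> R,
    [/\ lebesgue_measurable_fun `[0, T] k,
        forall t, 0 <= t <= T -> 0 <= k t &
        forall t x y, 0 <= t <= T -> eball 0 r x -> eball 0 r y ->
          `|lam t x - lam t y| <= k t * enorm (x - y)]
}.

End canonical_pair.

Definition cvg_uniform_on_compacts (U : topologicalType)
    (V : uniformType) (D : set U) (g_ : nat -> U -> V) (g : U -> V) :=
  {family [set K : set U | compact K /\ K `<=` D], g_ @ \oo --> g}.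

(* Main.v *)
(* Fix t and a compact set of pairs (x, a). Phi(t, x, a) is the part of the
   epigraph E of the conjugate of G = H(t, x, .) that lies in the ball of centre
   y = omega(t, x) a and radius 2 d(y, E), so everything can be estimated
   uniformly in (x, a), without extracting subsequences.
   (i) If G' is uniformly close to G on a large ball, every bounded part of the
   epigraph E of G* is contained in a small neighbourhood of the epigraph E' of
   G'*: for (v, s) in E, minimize G' - <v, .> + e |.|^2 / 2; the minimizer p0
   gives the subgradient v - e p0 of G', and a lower bound of G' - <v, .> by
   -s - d makes |e p0| of order sqrt e.
   (ii) Since the ball has twice the minimal radius, its intersection with a
   convex set E depends on (y, E) in a Lipschitz way, for the Hausdorff distance
   of bounded parts.
   (iii) The Steiner point is Lipschitz for the Hausdorff distance, because its
   coordinates are integrals of support functions against a finite measure. *)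

Require Import Defs.
From mathcomp Require Import all_boot all_order all_algebra.
From mathcomp Require Import all_classical all_reals all_analysis.
From mathcomp Require Import measurable_realfun ring lra.
Import Order.TTheory GRing.Theory Num.Theory.
Import numFieldNormedType.Exports.
Local Open Scope classical_set_scope.
Local Open Scope ring_scope.

Set Implicit Arguments.
Unset Strict Implicit.
Unset Printing Implicit Defensive.

(** * The Euclidean norm *)

Section euclidean_norm.
Context {R : realType} {m : nat}.
Implicit Types (x y z p : 'rV[R]_m) (a : R).

Lemma dotpC x y : dotp x y = dotp y x.
Proof. by apply: eq_bigr => i _; rewrite mulrC. Qed.

Lemma dotpDl x y z : dotp (x + y) z = dotp x z + dotp y z.
Proof. by rewrite /dotp -big_split; apply: eq_bigr => i _; rewrite !mxE mulrDl. Qed.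

Lemma dotpZl a x y : dotp (a *: x) y = a * dotp x y.
Proof. by rewrite /dotp mulr_sumr; apply: eq_bigr => i _; rewrite !mxE mulrA. Qed.

Lemma dotpNl x y : dotp (- x) y = - dotp x y.
Proof. by rewrite -scaleN1r dotpZl mulN1r. Qed.

Lemma dotpDr x y z : dotp x (y + z) = dotp x y + dotp x z.
Proof. by rewrite !(dotpC x) dotpDl. Qed.

Lemma dotpZr a x y : dotp x (a *: y) = a * dotp x y.
Proof. by rewrite !(dotpC x) dotpZl. Qed.

Lemma dotpNr x y : dotp x (- y) = - dotp x y.
Proof. by rewrite !(dotpC x) dotpNl. Qed.

Definition dotpE := (dotpDl, dotpDr, dotpNl, dotpNr, dotpZl, dotpZr).

Lemma dotp0r x : dotp x 0 = 0.
Proof. by rewrite -(scale0r 0) dotpZr mul0r. Qed.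

Lemma dotp_ge0 x : 0 <= dotp x x.
Proof. by apply: sumr_ge0 => i _; rewrite -expr2 sqr_ge0. Qed.

Lemma enorm_ge0 x : 0 <= enorm x.
Proof. exact: sqrtr_ge0. Qed.

Lemma sqr_enorm x : enorm x ^+ 2 = dotp x x.
Proof. by rewrite sqr_sqrtr ?dotp_ge0. Qed.

Lemma coord_le_enorm x i : `|x 0 i| <= enorm x.
Proof.
rewrite -sqrtr_sqr ler_wsqrtr// /dotp (bigD1 i)//= -expr2 lerDl.
by apply: sumr_ge0 => j _; rewrite -expr2 sqr_ge0.
Qed.

Lemma enorm_eq0 x : enorm x = 0 -> x = 0.
Proof.
move=> x0; apply/rowP => i; rewrite mxE; apply/eqP.
by rewrite -normr_le0 (le_trans (coord_le_enorm _ _))// x0.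
Qed.

Lemma enormZ a x : enorm (a *: x) = `|a| * enorm x.
Proof.
by rewrite /enorm dotpZl dotpZr mulrA -expr2 sqrtrM ?sqr_ge0// sqrtr_sqr.
Qed.

Lemma enormN x : enorm (- x) = enorm x.
Proof. by rewrite -scaleN1r enormZ normrN1 mul1r. Qed.

Lemma enorm0 : enorm (0 : 'rV[R]_m) = 0.
Proof. by rewrite -(scale0r 0) enormZ normr0 mul0r. Qed.

Lemma enormBC x y : enorm (x - y) = enorm (y - x).
Proof. by rewrite -enormN opprB. Qed.

Lemma dotp_le_enorm x y : dotp x y <= enorm x * enorm y.
Proof.
have [x0|x0] := eqVneq (enorm x) 0.
  by rewrite (enorm_eq0 x0) dotpC dotp0r enorm0 mul0r.
have [y0|y0] := eqVneq (enorm y) 0.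
  by rewrite (enorm_eq0 y0) dotp0r enorm0 mulr0.
have xy_gt0 : 0 < enorm x * enorm y by rewrite mulr_gt0// lt_def enorm_ge0 andbT.
(* The squared norm of this vector is [2 |x| |y| (|x| |y| - <x, y>)]. *)
have := dotp_ge0 (enorm y *: x - enorm x *: y).
rewrite !dotpE (dotpC y x) -!sqr_enorm => h.
rewrite -(ler_pM2l xy_gt0); nra.
Qed.

Lemma normr_dotp_le x y : `|dotp x y| <= enorm x * enorm y.
Proof.
by rewrite ler_norml dotp_le_enorm andbT lerNl -dotpNl -(enormN x) dotp_le_enorm.
Qed.

Lemma ler_enormD x y : enorm (x + y) <= enorm x + enorm y.
Proof.
rewrite -(@ler_pXn2r _ 2) ?nnegrE ?addr_ge0 ?enorm_ge0// sqr_enorm !dotpE.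
rewrite (dotpC y x) -!sqr_enorm; have := dotp_le_enorm x y; nra.
Qed.

Lemma ler_enormB x y : enorm (x - y) <= enorm x + enorm y.
Proof. by rewrite -(enormN y) ler_enormD. Qed.

Lemma ler_enorm_distD y x z : enorm (x - z) <= enorm (x - y) + enorm (y - z).
Proof. by rewrite (le_trans _ (ler_enormD _ _))// addrA subrK. Qed.

Lemma norm_le_enorm x : `|x| <= enorm x.
Proof.
rewrite [leLHS]/Num.norm /= mx_normrE; apply: bigmax_le; first exact: enorm_ge0.
by move=> [i j] _ /=; rewrite ord1 coord_le_enorm.
Qed.

Lemma coord_le_norm x i : `|x 0 i| <= `|x|.
Proof.
rewrite [leRHS]/Num.norm /= mx_normrE; apply/bigmax_geP; right => /=.
by exists (ord0, i).
Qed.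

(** Topology and compactness of row vectors refer to the sup norm; with [norm_le_enorm] this
    transfers them to the Euclidean norm. The constant comes from bounding [m] by its square under
    the root. *)
Lemma enorm_le_norm x : enorm x <= m%:R * `|x|.
Proof.
apply: (@le_trans _ _ (Num.sqrt ((m%:R * `|x|) ^+ 2))); last first.
  by rewrite sqrtr_sqr ger0_norm// mulr_ge0.
rewrite ler_wsqrtr// (@le_trans _ _ (\sum_(i < m) `|x| ^+ 2))//.
  apply: ler_sum => i _; rewrite -expr2 -real_normK ?num_real//.
  by rewrite lerXn2r ?nnegrE ?coord_le_norm.
rewrite sumr_const card_ord -[leLHS]mulr_natl exprMn ler_wpM2r ?sqr_ge0//.
by rewrite -natrX ler_nat; case: (m) => // k; rewrite -mulnn leq_pmulr.
Qed.

Lemma lipschitz_continuous (C : R) (f : 'rV[R]_m -> R) :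
  (forall x y, `|f x - f y| <= C * enorm (x - y)) -> continuous f.
Proof.
move=> fC x; have FF := nbhs_filter x; apply/cvgrPdist_lt => e e0.
have D0 : 0 < `|C| * m%:R + 1 by rewrite ltr_wpDl// mulr_ge0.
near=> y; apply: le_lt_trans (fC x y) _.
apply: (@le_lt_trans _ _ ((`|C| * m%:R + 1) * `|x - y|)).
  rewrite mulrDl mul1r ler_wpDr// -mulrA.
  apply: (@le_trans _ _ (`|C| * enorm (x - y))).
    by rewrite ler_wpM2r ?enorm_ge0 ?ler_norm.
  by rewrite ler_wpM2l ?enorm_le_norm.
rewrite mulrC -ltr_pdivlMr//; near: y.
have xx : id y @[y --> x] --> x by exact: cvg_id.
by move/cvgrPdist_lt : xx; apply; exact: divr_gt0.
Unshelve. all: by end_near. Qed.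

Lemma continuous_enorm : continuous (@enorm R m : 'rV[R]_m -> R).
Proof.
apply: (@lipschitz_continuous 1) => x y; rewrite mul1r ler_norml.
have := ler_enormD (x - y) y; have := ler_enormD (y - x) x.
by rewrite !subrK (enormBC y) => *; apply/andP; split; lra.
Qed.

Lemma compact_eball (r : R) : compact (eball (0 : 'rV[R]_m) r).
Proof.
apply: bounded_closed_compact.
  exists r; split; first exact: num_real.
  move=> M rM x; rewrite /eball/= subr0 => xr.
  by rewrite (le_trans (norm_le_enorm x))// (le_trans xr)// ltW.
rewrite (_ : eball _ _ = @enorm R m @^-1` [set y | y <= r]).
  by apply: preimage_closed => [x _|]; [exact: continuous_enorm|exact: closed_le].
by apply/seteqP; split => x; rewrite /eball/= subr0.
Qed.

Lemma eball0E (r : R) x : eball 0 r x = (enorm x <= r).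
Proof. by rewrite /eball/= subr0. Qed.

End euclidean_norm.

(** * Norms of pairs in R^n x R written as row vectors *)

Section row_mx_norm.
Context {R : realType} {n : nat}.
Implicit Types (z : 'rV[R]_(n + 1)) (v : 'rV[R]_n) (s : R).

Lemma sqr_enorm_row_mx v s :
  enorm (row_mx v s%:M) ^+ 2 = enorm v ^+ 2 + s ^+ 2.
Proof.
rewrite !sqr_enorm /dotp big_split_ord/= big_ord1 !row_mxEr !mxE/=.
by rewrite mulr1n -expr2; congr (_ + _); apply: eq_bigr => i _; rewrite row_mxEl.
Qed.

Lemma row_mx_sub z : z = row_mx (lsubmx z) (rsubmx z 0 0)%:M.
Proof. by rewrite -[LHS]hsubmxK; congr row_mx; exact: mx11_scalar. Qed.

Lemma enorm_row_mx_le v s : enorm (row_mx v s%:M) <= enorm v + `|s|.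
Proof.
rewrite -(@ler_pXn2r _ 2) ?nnegrE ?addr_ge0 ?enorm_ge0//.
rewrite sqr_enorm_row_mx -(real_normK (num_real s)).
have := enorm_ge0 v; have := normr_ge0 s; nra.
Qed.

Lemma enorm_lsubmx_le z : enorm (lsubmx z) <= enorm z.
Proof.
rewrite {2}(row_mx_sub z) -(@ler_pXn2r _ 2) ?nnegrE ?enorm_ge0//.
by rewrite sqr_enorm_row_mx lerDl sqr_ge0.
Qed.

Lemma normr_rsubmx_le z : `|rsubmx z 0 0| <= enorm z.
Proof.
rewrite {2}(row_mx_sub z) -(@ler_pXn2r _ 2) ?nnegrE ?enorm_ge0//.
by rewrite sqr_enorm_row_mx real_normK ?num_real// lerDr sqr_ge0.
Qed.

End row_mx_norm.

(** * Points of a set at almost minimal distance *)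

(* [all_analysis] exports another [edist]. *)
Local Notation edist := Defs.edist.

Section distance.
Context {R : realType} {m : nat}.
Implicit Types (y z : 'rV[R]_m) (E K : set 'rV[R]_m).

Let dists_lb y E : has_lbound [set enorm (y - z) | z in E].
Proof. by exists 0 => _ [z _ <-]; exact: enorm_ge0. Qed.

Lemma edist_ge0 y E : E !=set0 -> 0 <= edist y E.
Proof.
move=> [z Ez]; apply: lb_le_inf; first by exists (enorm (y - z)); exists z.
by move=> _ [w _ <-]; exact: enorm_ge0.
Qed.

Lemma edist_le y E z : E z -> edist y E <= enorm (y - z).
Proof. by move=> Ez; apply: ge_inf => //; exists z. Qed.

Lemma edist_lt_near y E (e : R) : E !=set0 -> 0 < e ->
  exists2 z, E z & enorm (y - z) < edist y E + e.
Proof.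
move=> [z Ez] e0.
have h : has_inf [set enorm (y - z) | z in E].
  by split => //; exists (enorm (y - z)); exists z.
by have [_ [w Ew <-] wlt] := inf_adherent e0 h; exists w.
Qed.

(** One half of a truncated Hausdorff distance: epigraphs are unbounded, so closeness is asked only
    for the points of [E] of norm at most [rho]. *)
Definition within_on (rho e : R) E E' :=
  forall z, E z -> enorm z <= rho -> exists2 z', E' z' & enorm (z - z') <= e.

Definition segment_closed E := forall z w (s : R),
  0 <= s <= 1 -> E z -> E w -> E ((1 - s) *: z + s *: w).

Definition adherence_closed E := forall y,
  (forall e : R, 0 < e -> exists2 z, E z & enorm (y - z) <= e) -> E y.

Definition near_part E y := E `&` eball y (2 * edist y E).

(** The radius [rho] leaves room for a point of [E] nearest to [y] up to [e]; passing to its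
    companion in [E'] costs another [e]. *)
Lemma edist_within rho e E E' y y' : E !=set0 -> 0 < e ->
  within_on rho e E E' -> enorm y + edist y E + e <= rho ->
  edist y' E' <= edist y E + (enorm (y - y') + 2 * e).
Proof.
move=> E0 e0 EE' rhoE; have [z Ez yz] := edist_lt_near y E0 e0.
have [|z' E'z' zz'] := EE' z Ez.
  have := ler_enormD (z - y) y; rewrite subrK (enormBC z y) => ?; lra.
apply: le_trans (edist_le y' E'z') _.
have := ler_enorm_distD z y z'; have := ler_enorm_distD y y' z'.
rewrite (enormBC y' y); lra.
Qed.

(** If the distance is positive, the factor 2 leaves the distance itself as slack above the infimum;
    at distance zero, closedness puts [y] in [E]. *)
Lemma near_point E y : E !=set0 -> adherence_closed E ->
  exists2 w, E w & enorm (y - w) <= 2 * edist y E.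
Proof.
move=> E0 Ecl; have := edist_ge0 y E0; rewrite le_eqVlt => /orP[/eqP d0|d0].
  exists y; last by rewrite -d0 subrr enorm0 mulr0.
  apply: Ecl => e e0; have [z Ez yz] := edist_lt_near y E0 e0.
  by exists z => //; rewrite ltW// (lt_le_trans yz)// -d0 add0r.
have [w Ew yw] := edist_lt_near y E0 d0.
by exists w => //; rewrite mulr2n mulrDl mul1r ltW.
Qed.

Lemma near_part_neq0 E y : E !=set0 -> adherence_closed E -> near_part E y !=set0.
Proof.
move=> E0 Ecl; have [w Ew yw] := near_point y E0 Ecl.
by exists w; split => //; rewrite /eball/= enormBC.
Qed.

(* A point of [E'] that is slightly too far from [y'] is pulled back into the
   ball of radius [2 * edist y' E'] along the segment to an almost nearest
   point, at a cost proportional to the excess because the ball has twice the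
   minimal radius; when [edist y' E'] itself is small, both sets are small. *)
Lemma near_part_within (rho e : R) E E' y y' :
  E !=set0 -> E' !=set0 -> segment_closed E' -> adherence_closed E' -> 0 < e ->
  within_on rho e E E' -> within_on rho e E' E ->
  enorm y + 2 * edist y E + e <= rho -> enorm y' + edist y' E' + e <= rho ->
  forall z, near_part E y z -> exists2 z', near_part E' y' z' &
    enorm (z - z') <= 15 * (enorm (y - y') + 2 * e).
Proof.
move=> E0 E'0 cvE' clE' e0 EE' E'E rhoE rhoE' z [Ez].
rewrite /eball/= => zy.
set k := enorm (y - y') + 2 * e.
have dd' : edist y E <= edist y' E' + k.
  by rewrite /k (enormBC y y'); exact: edist_within E'E _.
have d'_ge0 := edist_ge0 y' E'0; have d_ge0 := edist_ge0 y E0.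
have yy'_ge0 := enorm_ge0 (y - y').
have k0 : 0 < k by rewrite /k; lra.
(* Write [d'] for [edist y' E']. In the first case every point of the second near part is within
   [4 d' + 3 k < 15 k] of [z], whence the constant 15. *)
have [d'k|d'k] := ltP (edist y' E') (3 * k).
  have [w E'w y'w] := near_point y' E'0 clE'.
  exists w; first by split => //; rewrite /eball/= enormBC.
  have := ler_enorm_distD y z w; have := ler_enorm_distD y' y w.
  by rewrite /k in k0 dd' d'k *; lra.
have [z' E'z' zz'] : exists2 z', E' z' & enorm (z - z') <= e.
  apply: EE' => //; have := ler_enormD (z - y) y; rewrite subrK; lra.
have [w E'w y'w] := edist_lt_near y' E'0 k0.
have z'y' : enorm (z' - y') <= 2 * edist y' E' + 3 * k.
  have := ler_enorm_distD z z' y'; have := ler_enorm_distD y z y'.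
  rewrite (enormBC z' z); rewrite /k in k0 dd' d'k *; lra.
have d'_gt0 : 0 < edist y' E' by lra.
(* [z'] exceeds the radius [2 d'] by at most [3 k], and [w] is within [d' + k] of [y']. Moving by
   the fraction [s] with [s d' = 3 k] removes the excess, and the total displacement from [z] is at
   most [k + s (3 d' + 4 k) <= 14 k]. *)
pose s := 3 * k / edist y' E'.
have sd : s * edist y' E' = 3 * k by rewrite /s divfK// gt_eqF.
have s01 : 0 <= s <= 1.
  apply/andP; split; first by rewrite divr_ge0// mulr_ge0// ltW.
  by rewrite ler_pdivrMr// mul1r.
have /andP[s_ge0 s_le1] := s01.
exists ((1 - s) *: z' + s *: w); first split.
- exact: cvE'.
- rewrite /eball/=.
  have -> : (1 - s) *: z' + s *: w - y' = (1 - s) *: (z' - y') + s *: (w - y').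
    by apply/rowP => i; rewrite !mxE; ring.
  apply: le_trans (ler_enormD _ _) _; rewrite !enormZ.
  rewrite ger0_norm ?subr_ge0// ger0_norm// (enormBC w y').
  have h1 : (1 - s) * enorm (z' - y') <= (1 - s) * (2 * edist y' E' + 3 * k).
    by rewrite ler_wpM2l ?subr_ge0.
  have h2 : s * enorm (y' - w) <= s * (edist y' E' + k).
    by rewrite ler_wpM2l// ltW.
  nra.
- have -> : z - ((1 - s) *: z' + s *: w) = (z - z') + s *: (z' - w).
    by apply/rowP => i; rewrite !mxE; ring.
  apply: le_trans (ler_enormD _ _) _; rewrite enormZ ger0_norm//.
  have h : s * enorm (z' - w) <= s * (3 * edist y' E' + 4 * k).
    rewrite ler_wpM2l//; have := ler_enorm_distD y' z' w; lra.
  have sk : s * k <= k by rewrite ler_piMl// ltW.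
  have : enorm (z - z') <= k by rewrite /k; lra.
  nra.
Qed.

End distance.

(** * Support functions of bounded sets *)

Section support.
Context {R : realType} {m : nat}.
Implicit Types (p q x : 'rV[R]_m) (K : set 'rV[R]_m) (rho e : R).

Lemma dotp_le_support rho K p x : K `<=` eball 0 rho -> K x ->
  dotp p x <= support_fun K p.
Proof.
move=> Krho Kx; apply: ub_le_sup; last by exists x.
exists (enorm p * rho) => _ [z /Krho + <-]; rewrite eball0E => zrho.
by rewrite (le_trans (dotp_le_enorm _ _))// ler_wpM2l ?enorm_ge0.
Qed.

Lemma support_le K p b : K !=set0 -> (forall x, K x -> dotp p x <= b) ->
  support_fun K p <= b.
Proof.
move=> [x Kx] Kb; apply: ge_sup; first by exists (dotp p x); exists x.
by move=> _ [z /Kb zb <-].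
Qed.

Lemma support_within rho K K' p e : K !=set0 -> K' `<=` eball 0 rho ->
  (forall z, K z -> exists2 z', K' z' & enorm (z - z') <= e) ->
  support_fun K p <= support_fun K' p + enorm p * e.
Proof.
move=> K0 K'rho KK'; apply: support_le => // x Kx; have [x' K'x' xx'] := KK' x Kx.
have -> : dotp p x = dotp p x' + dotp p (x - x') by rewrite -dotpDr addrC subrK.
apply: lerD; first exact: dotp_le_support K'rho _.
by rewrite (le_trans (dotp_le_enorm _ _))// ler_wpM2l ?enorm_ge0.
Qed.

(** Provides the continuity in [p], hence the measurability, of the integrand of the Steiner
    point. *)
Lemma support_lipschitz rho K p q : K !=set0 -> K `<=` eball 0 rho ->
  `|support_fun K p - support_fun K q| <= rho * enorm (p - q).
Proof.
move=> K0 Krho.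
have lip u v : support_fun K u <= support_fun K v + rho * enorm (u - v).
  apply: support_le => // x Kx.
  have -> : dotp u x = dotp v x + dotp (u - v) x by rewrite -dotpDl addrC subrK.
  apply: lerD; first exact: dotp_le_support Krho _.
  rewrite (le_trans (dotp_le_enorm _ _))// mulrC ler_wpM2r ?enorm_ge0//.
  by rewrite -eball0E; exact: Krho.
have := lip p q; have := lip q p; rewrite (enormBC q p) ler_norml => *.
by apply/andP; split; lra.
Qed.

Lemma support_bound rho K p : K !=set0 -> K `<=` eball 0 rho ->
  `|support_fun K p| <= rho * enorm p.
Proof.
move=> K0 Krho; have := support_lipschitz p 0 K0 Krho; rewrite subr0.
suff -> : support_fun K 0 = 0 by rewrite subr0.
rewrite /support_fun (_ : [set _ | _ in _] = [set 0]) ?sup1//.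
apply/seteqP; split => [_ [x _ <-]|_ ->] /=; first by rewrite dotpC dotp0r.
by have [x Kx] := K0; exists x => //; rewrite dotpC dotp0r.
Qed.

End support.

(** * Steiner points *)

Section measurability.
Context {R : realType} {m : nat}.

(** Half-open grid cubes of side [1 / (k + 1)]: for each [k] they partition the space, and they are
    countably many in all. *)
Let cell (kz : nat * 'rV[int]_m) : set 'rV[R]_m :=
  [set p | forall i, Num.floor (kz.1.+1%:R * p 0 i) = kz.2 0 i].

Let measurable_cell kz : measurable (cell kz).
Proof.
rewrite (_ : cell kz = \bigcap_(i in [set: 'I_m])
    ((fun p : 'rV[R]_m => p 0 i : measurableTypeR R) @^-1`
      `[(kz.2 0 i)%:~R / kz.1.+1%:R, (kz.2 0 i + 1)%:~R / kz.1.+1%:R[)).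
  apply: fin_bigcap_measurable; first exact: finite_finset.
  by move=> i _; rewrite -[X in measurable X]setTI; exact: measurable_coord.
have k0 : 0 < kz.1.+1%:R :> R by [].
apply/seteqP; split => [p pk i _|p pk i].
- rewrite /= in_itv/= ler_pdivrMr// ltr_pdivlMr// mulrC -(pk i).
  exact: floor_itv.
- have := pk i I; rewrite /= in_itv/= ler_pdivrMr// ltr_pdivlMr// mulrC => h.
  exact: floor_def.
Qed.

Let cell_small k z p q : cell (k, z) p -> cell (k, z) q ->
  `|p - q| <= k.+1%:R^-1.
Proof.
move=> zp zq; rewrite [leLHS]/Num.norm /= mx_normrE.
apply: bigmax_le => // -[i j] _ /=; rewrite ord1 !mxE.
have k0 : 0 < k.+1%:R :> R by [].
rewrite -[leRHS]mul1r ler_pdivlMr// -{1}(gtr0_norm k0) -normrM mulrBl.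
have := floor_itv (k.+1%:R * p 0 j); have := floor_itv (k.+1%:R * q 0 j).
rewrite (zp j) (zq j)/= ler_norml intrD; set a := _%:~R; set b := _%:~R.
by move=> /andP[? ?] /andP[? ?]; apply/andP; split; lra.
Qed.

(** An open set is the countable union of the grid cells it contains. This links the topology to the
    sigma-algebra generated by the coordinates. *)
Lemma open_measurable_rV (U : set 'rV[R]_m) : open U -> measurable U.
Proof.
move=> oU.
rewrite (_ : U = \bigcup_(kz : nat * 'rV[int]_m)
    (if `[< cell kz `<=` U >] then cell kz else set0)).
  apply: countable_bigcupT_measurable; first exact: countableP.
  by move=> kz; case: ifP.
apply/seteqP; split => [p Up|p [kz _]]; last by case: ifPn => // /asboolP; apply.
have /nbhs_ballP[e /= e0 eU] : nbhs p U by exact: open_nbhs_nbhs.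
(* Then [e^-1 < k + 1], so two points of a cell are less than [e] apart in sup norm. *)
pose k := Num.trunc e^-1.
pose z : 'rV[int]_m := \row_i Num.floor (k.+1%:R * p 0 i).
have zp : cell (k, z) p by move=> i; rewrite mxE.
exists (k, z) => //; case: asboolP => // -[] q zq; apply: eU.
rewrite -ball_normE/=; apply: le_lt_trans (cell_small zp zq) _.
by rewrite invf_plt ?posrE//; exact: truncnS_gt.
Qed.

Lemma continuous_measurable_rV (f : 'rV[R]_m -> R) : continuous f ->
  measurable_fun setT (f : _ -> measurableTypeR R).
Proof.
move=> /continuousP cf; apply: (measurability _ (RGenOpens.measurableE R)).
move=> _ [_ [a [b ->] <-]]; rewrite setTI; apply: open_measurable_rV.
exact/cf/interval_open.
Qed.

End measurability.

Section steiner_point.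
Context {R : realType} {m : nat}.
Implicit Types (K : set 'rV[R]_m) (rho e : R).

Let mu := @sphere_measure R m.

Lemma measurable_esphere : measurable (@esphere R m).
Proof.
rewrite -[X in measurable X]setTI.
exact: (continuous_measurable_rV continuous_enorm) (measurable_set1 1).
Qed.

(* If the ball had infinite volume, the normalizing factor would be
   [(fine +oo)^-1 = 0]; the volume of the ball is therefore not needed. *)
Lemma sphere_measure_finite : (mu esphere < +oo)%E.
Proof.
apply: (@le_lt_trans _ _ (mu setT)).
  by apply: le_measure; rewrite ?inE//; exact: measurable_esphere.
rewrite /mu /sphere_measure (_ : [set _ | _] = eball 0 1); last first.
  by apply/seteqP; split => [x []//|x x1]; split.
by case: (lebesgue_rV _) => [r||] /=; rewrite -?EFinM ?invr0 ?mul0e ltry.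
Qed.

Lemma integrable_coord_support rho K (j : 'I_m) : K !=set0 -> K `<=` eball 0 rho ->
  mu.-integrable esphere (EFin \o (fun p : 'rV[R]_m => p 0 j * support_fun K p)).
Proof.
move=> K0 Krho; apply: measurable_bounded_integrable => //.
- exact: measurable_esphere.
- exact: sphere_measure_finite.
- apply: measurable_funTS; apply: measurable_funM; first exact: measurable_coord.
  apply: continuous_measurable_rV; apply: lipschitz_continuous => p q.
  exact: support_lipschitz K0 Krho.
- exists rho; split; first exact: num_real.
  move=> M rhoM p; rewrite /esphere/= => p1.
  rewrite normrM (@le_trans _ _ (1 * rho))//; last by rewrite mul1r ltW.
  apply: ler_pM => //; first by rewrite -p1 coord_le_enorm.
  by rewrite -[leRHS]mulr1 -p1 support_bound.
Qed.

(** On the unit sphere a coordinate has modulus at most 1 and the two support functions differ by at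
    most [e]; integration multiplies this by the mass of the sphere. *)
Lemma steiner_close rho e K K' (j : 'I_m) :
  K !=set0 -> K' !=set0 -> K `<=` eball 0 rho -> K' `<=` eball 0 rho ->
  (forall z, K z -> exists2 z', K' z' & enorm (z - z') <= e) ->
  (forall z, K' z -> exists2 z', K z' & enorm (z - z') <= e) ->
  `|steiner K 0 j - steiner K' 0 j| <= m%:R * (e * fine (mu esphere)).
Proof.
move=> K0 K'0 Krho K'rho KK' K'K; rewrite !mxE -mulrBr normrM.
rewrite ger0_norm// ler_wpM2l//.
have iK := integrable_coord_support j K0 Krho.
have iK' := integrable_coord_support j K'0 K'rho.
have mS := measurable_esphere.
rewrite -RintegralB//.
have iB : mu.-integrable esphere (EFin \o
    (fun p : 'rV[R]_m => p 0 j * support_fun K p - p 0 j * support_fun K' p)).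
  by have := integrableB mS iK iK'.
apply: le_trans (le_normr_Rintegral mS iB) _.
rewrite -Rintegral_cst//; apply: le_Rintegral => //.
- exact: integrable_norm.
- apply: measurable_bounded_integrable => //; first exact: sphere_measure_finite.
  exists `|e|; split; first exact: num_real.
  by move=> M eM p _; exact: ltW.
- move=> p; rewrite /esphere/= => p1; rewrite -mulrBr normrM.
  have -> : e = 1 * e by rewrite mul1r.
  apply: ler_pM => //; first by rewrite -p1 coord_le_enorm.
  have := support_within p K0 K'rho KK'; have := support_within p K'0 Krho K'K.
  by rewrite p1 !mul1r ler_norml => *; apply/andP; split; lra.
Qed.

End steiner_point.

(** * Epigraphs of conjugate functions *)

Section conjugate_epigraph.
Context {R : realType} {n : nat}.
Implicit Types (G : 'rV[R]_n -> R) (v p q : 'rV[R]_n) (z : 'rV[R]_(n + 1)).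

(** The epigraph of the convex conjugate of [G], as an intersection of half-spaces, so that only
    real inequalities occur. *)
Definition conj_epi G : set 'rV[R]_(n + 1) :=
  [set z | forall p, dotp (lsubmx z) p - G p <= rsubmx z 0 0].

Definition finite_convex G := forall (s : R) p q, 0 <= s <= 1 ->
  G ((1 - s) *: p + s *: q) <= (1 - s) * G p + s * G q.

(* [G] is a real-valued convex function with the linear lower bound that makes
   [G - <v, .> + e / 2 |.|^2] coercive, normalized by [|G 0| <= B]. *)
Record tame (M B : R) G : Prop := {
  tame_convex : finite_convex G ;
  tame_continuous : continuous G ;
  tame_lower : forall p, G 0 - M * enorm p <= G p ;
  tame_at0 : `|G 0| <= B
}.

Lemma segment_closed_conj_epi G : segment_closed (conj_epi G).
Proof.
move=> z w s /andP[s0 s1] Ez Ew p.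
have := ler_wpM2l s0 (Ew p); have : (1 - s) * (dotp (lsubmx z) p - G p) <=
  (1 - s) * rsubmx z 0 0 by rewrite ler_wpM2l ?subr_ge0.
rewrite !linearD !linearZ /= !dotpE.
move: (rsubmx z) (rsubmx w) => a b; rewrite !mxE; nra.
Qed.

(** Moving a point by [delta] changes the inequality at [p] by at most [delta (|p| + 1)], whence the
    tolerance [e / (|p| + 1)]. *)
Lemma adherence_closed_conj_epi G : adherence_closed (conj_epi G).
Proof.
move=> z zE p; apply/ler_addgt0Pr => e e0.
have c0 : 0 < enorm p + 1 by rewrite ltr_wpDl ?enorm_ge0.
have [w Ew zw] := zE _ (divr_gt0 e0 c0).
have {}zw : (enorm p + 1) * enorm (z - w) <= e by rewrite mulrC -ler_pdivlMr.
have h1 : dotp (lsubmx (z - w)) p <= enorm (z - w) * enorm p.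
  apply: le_trans (dotp_le_enorm _ _) _.
  by rewrite ler_wpM2r ?enorm_ge0 ?enorm_lsubmx_le.
have h2 : - enorm (z - w) <= rsubmx (z - w) 0 0.
  by have := normr_rsubmx_le (z - w); rewrite ler_norml => /andP[].
have := Ew p; move: h1 h2; rewrite !linearB/= !dotpE.
move: (rsubmx z) (rsubmx w) => a b; rewrite !mxE => *; nra.
Qed.

(* The minimizer [p0] of [G - <v, .> + e / 2 |.|^2] exhibits [v - e p0] as a
   subgradient of [G] at [p0]. *)
Lemma proximal_point (M B e : R) G v : 0 <= M -> tame M B G -> 0 < e ->
  exists p0, [/\ enorm p0 <= 2 * (M + enorm v) / e,
    G p0 - dotp v p0 + e / 2 * dotp p0 p0 <= G 0 &
    forall p, dotp (v - e *: p0) p - G p <= dotp (v - e *: p0) p0 - G p0].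
Proof.
(* Outside the ball of radius [r] the lower bound [G 0 - (M + |v|) |p| + e |p|^2 / 2] is at least
   [G 0], so a minimizer over the ball is global. *)
move=> M0 [cvG ctG lowG _] e0; set r := 2 * (M + enorm v) / e.
have v0 := enorm_ge0 v.
have r0 : 0 <= r by rewrite divr_ge0 ?mulr_ge0 ?addr_ge0// ltW.
have er : e * r = 2 * (M + enorm v) by rewrite /r mulrC divfK// gt_eqF.
pose F p := G p - dotp v p + e / 2 * dotp p p.
have ctF : continuous F.
  move=> p; have FF := nbhs_filter p.
  apply: cvgD; first apply: cvgB; first exact: ctG.
    apply: (@lipschitz_continuous _ _ (enorm v)) => x y.
    by rewrite -dotpNr -dotpDr normr_dotp_le.
  under eq_cvg do rewrite -sqr_enorm; rewrite -sqr_enorm.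
  by apply: cvgM; [exact: cvg_cst|apply: cvgM; exact: continuous_enorm].
have [|p0 p0r minF] := EVT_min_rV _ (@compact_eball _ _ r) (continuous_subspaceT ctF).
  by exists 0; rewrite eball0E enorm0.
move: p0r; rewrite inE eball0E => p0r.
have minF0 : F p0 <= G 0.
  have := minF 0; rewrite /F !dotp0r mulr0 addr0 subr0; apply.
  by rewrite inE eball0E enorm0.
have {}minF p : F p0 <= F p.
  have [pr|rp] := leP (enorm p) r; first by apply: minF; rewrite inE eball0E.
  apply: le_trans minF0 _; rewrite /F -sqr_enorm.
  have h1 := lowG p; have h2 := dotp_le_enorm v p.
  have h3 : e * r * enorm p <= e * enorm p * enorm p.
    by rewrite ler_wpM2r ?enorm_ge0// ler_wpM2l ?ltW.
  rewrite er in h3; nra.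
exists p0; split => // p.
(* First-order condition: compare [p0] with [p0 + s (p - p0)], use convexity and divide by [s]. The
   remaining error is [s c] with [c = e |p - p0|^2 / 2], and [s] is chosen to make it at most
   [d]. *)
apply/ler_addgt0Pr => d d0.
have c0 : 0 < e / 2 * dotp (p - p0) (p - p0) + 1.
  by rewrite ltr_wpDl// mulr_ge0 ?dotp_ge0// divr_ge0 ?ltW.
set c := e / 2 * _ in c0.
pose s := Num.min 1 (d / (c + 1)).
have s0 : 0 < s by rewrite lt_min ltr01 divr_gt0.
have s1 : s <= 1 by rewrite ge_min lexx.
have sc : s * (c + 1) <= d by rewrite -ler_pdivlMr// ge_min lexx orbT.
have sC : s * c <= d by nra.
have s01 : 0 <= s <= 1 by rewrite s1 ltW.
have := minF ((1 - s) *: p0 + s *: p); have := cvG s p0 p s01.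
have -> : (1 - s) *: p0 + s *: p = p0 + s *: (p - p0).
  by apply/rowP => i; rewrite !mxE; ring.
rewrite /F !dotpE (dotpC p p0) /c !dotpE (dotpC p p0) in sC *.
move=> h1 h2.
rewrite -(ler_pM2l s0).
nra.
Qed.

Lemma row_mx_conj_epi G v (s : R) :
  (forall p, dotp v p - G p <= s) -> conj_epi G (row_mx v s%:M).
Proof. by move=> vs p; rewrite row_mxKl row_mxKr mxE eqxx mulr1n. Qed.

(** The proximal point for [v = 0] and [e = 1] gives the subgradient [- p0] with [|p0| <= 2 M]. The
    bound is common to all tame [G], so it controls the distance to all their epigraphs at once. *)
Lemma conj_epi_bounded_point (M B : R) G : 0 <= M -> tame M B G ->
  exists2 z, conj_epi G z & enorm z <= 2 * M + 4 * M ^+ 2 + B.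
Proof.
move=> M0 tG; have [p0 [p0M minp0 subp0]] := proximal_point 0 M0 tG ltr01.
move: p0M minp0 subp0; rewrite enorm0 addr0 divr1 -sqr_enorm.
rewrite dotpC dotp0r subr0 scale1r sub0r => p0M minp0 subp0.
exists (row_mx (- p0) (dotp (- p0) p0 - G p0)%:M); first exact: row_mx_conj_epi.
apply: le_trans (enorm_row_mx_le _ _) _.
rewrite enormN dotpNl -sqr_enorm -opprD normrN.
have := tame_lower tG p0; have := tame_at0 tG; have := enorm_ge0 p0.
rewrite ler_norml => N0 /andP[GB1 GB2] low.
have h : enorm p0 ^+ 2 <= 4 * M ^+ 2 by nra.
have h1 : M * enorm p0 <= 2 * M ^+ 2 by nra.
have M2 := sqr_ge0 M; have N2 := sqr_ge0 (enorm p0).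
have h2 : `|enorm p0 ^+ 2 + G p0| <= 4 * M ^+ 2 + B.
  by rewrite ler_norml; apply/andP; split; lra.
lra.
Qed.

(* The subgradients [v - e p0] of [G'] are close to [v] because [G' - <v, .>]
   is bounded below by about [- s] near [p0], so that [e |p0|^2] is bounded. *)
Lemma conj_epi_within (M B rho eps : R) :
    0 <= M -> 0 <= B -> 0 <= rho -> 0 < eps ->
  exists r d : R, 0 < d /\ forall G G', tame M B G' ->
    (forall p, enorm p <= r -> `|G p - G' p| <= d) ->
    within_on rho eps (conj_epi G) (conj_epi G').
Proof.
move=> M0 B0 rho0 eps0; pose d := eps / 2.
have d0 : 0 < d by rewrite divr_gt0.
(* As [e |p0|^2 <= 2 (B + rho + d)] will hold, this choice gives [e |p0| <= d]; the two components
   of the displacement then contribute at most [d = eps / 2] each. *)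
pose e := d ^+ 2 / (2 * (B + rho + d)).
have c0 : 0 < 2 * (B + rho + d) by lra.
have e0 : 0 < e by rewrite divr_gt0// exprn_gt0.
have ed : e * (2 * (B + rho + d)) = d ^+ 2 by rewrite divfK// gt_eqF.
exists (2 * (M + rho) / e), d; split => // G G' tG' GG' z Ez zrho.
set v := lsubmx z; set s := rsubmx z 0 0.
have vrho : enorm v <= rho by apply: le_trans zrho; exact: enorm_lsubmx_le.
have srho : s <= rho.
  by apply: le_trans zrho; apply: le_trans (normr_rsubmx_le z); exact: ler_norm.
have [p0 [p0M minp0 subp0]] := proximal_point v M0 tG' e0.
have {}p0M : enorm p0 <= 2 * (M + rho) / e.
  by apply: le_trans p0M _; rewrite ler_pM2r ?invr_gt0// ler_wpM2l ?lerD2l.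
have := GG' p0 p0M; rewrite ler_norml => /andP[_ GG'p0].
have := Ez p0; rewrite -/v -/s => vp0.
have := tame_at0 tG'; rewrite ler_norml => /andP[_ G'0].
(* The conjugate of [G'] at the subgradient [v - e p0] is attained at [p0], so it is at most
   [<v, p0> - G' p0 <= s + d]. *)
exists (row_mx (v - e *: p0) (s + d)%:M).
  apply: row_mx_conj_epi => p; apply: le_trans (subp0 p) _.
  rewrite !dotpE; have := mulr_ge0 (ltW e0) (dotp_ge0 p0); lra.
have -> : z - row_mx (v - e *: p0) (s + d)%:M = row_mx (e *: p0) (- d)%:M.
  rewrite {1}(row_mx_sub z) -/v -/s opp_row_mx add_row_mx.
  by congr row_mx; [rewrite opprB addrCA subrr addr0|rewrite -raddfB opprD addNKr].
apply: le_trans (enorm_row_mx_le _ _) _.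
rewrite enormZ normrN !gtr0_norm//.
suff : e * enorm p0 <= d by have : d = eps / 2 by []; lra.
rewrite -(@ler_pXn2r _ 2) ?nnegrE ?(ltW d0) ?(mulr_ge0 (ltW e0) (enorm_ge0 p0))//.
rewrite -sqr_enorm in minp0; have {}minp0 : e * enorm p0 ^+ 2 <= 2 * (B + rho + d).
  lra.
have -> : (e * enorm p0) ^+ 2 = e * (e * enorm p0 ^+ 2) by ring.
by rewrite -ed ler_pM2l.
Qed.

End conjugate_epigraph.

(** * Stability of the Steiner point of a near part *)

Section stability.
Context {R : realType} {n : nat}.
Implicit Types (G : 'rV[R]_n -> R) (y : 'rV[R]_(n + 1)).

Lemma near_part_bounded (M B W : R) G y : 0 <= M -> tame M B G ->
  enorm y <= W ->
  near_part (conj_epi G) y `<=`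
    eball 0 (W + 2 * (W + (2 * M + 4 * M ^+ 2 + B))).
Proof.
move=> M0 tG yW z [_]; rewrite eball0E /eball/= => zy.
have [w Ew wM] := conj_epi_bounded_point M0 tG.
have := edist_le y Ew; have := ler_enormB y w; have := ler_enormD (z - y) y.
rewrite subrK; lra.
Qed.

(** Chains the three estimates. The thresholds [r] and [d] depend only on [M], [B], [W] and [eps],
    which makes the later convergence uniform in [(x, a)]. *)
Lemma steiner_near_part_stable (M B W eps : R) :
    0 <= M -> 0 <= B -> 0 <= W -> 0 < eps ->
  exists r d : R, 0 < d /\ forall G G' y y',
    tame M B G -> tame M B G' -> enorm y <= W -> enorm y' <= W ->
    enorm (y - y') <= d -> (forall p, enorm p <= r -> `|G p - G' p| <= d) ->
    forall j, `|steiner (near_part (conj_epi G) y) 0 j -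
                steiner (near_part (conj_epi G') y') 0 j| <= eps.
Proof.
move=> M0 B0 W0 eps0.
pose S : R := fine (@sphere_measure R (n + 1) esphere).
have S0 : 0 <= S by rewrite fine_ge0.
have mS0 : 0 <= (n + 1)%:R * S by rewrite mulr_ge0.
(* Centres at distance at most [e] put the near parts within [15 (e + 2 e) = 45 e] of each other;
   the added 1 keeps the denominator positive. *)
pose e := Num.min 1 (eps / (45 * ((n + 1)%:R * S + 1))).
have e0 : 0 < e by rewrite lt_min ltr01 divr_gt0// mulr_gt0// ltr_wpDl.
have e1 : e <= 1 by rewrite ge_min lexx.
have eeps : e * (45 * ((n + 1)%:R * S + 1)) <= eps.
  by rewrite -ler_pdivlMr ?mulr_gt0 ?ltr_wpDl// ge_min lexx orbT.
(* [D] bounds the distance from a centre of norm at most [W] to any of the epigraphs; [rho] then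
   covers [|y| + 2 edist + e], as [e <= 1]. *)
pose D := W + (2 * M + 4 * M ^+ 2 + B).
have D0 : 0 <= D by rewrite !addr_ge0 ?mulr_ge0 ?sqr_ge0.
pose rho := W + 2 * D + 1.
have rho0 : 0 <= rho by rewrite /rho; lra.
have [r [d [d0 Hd]]] := @conj_epi_within R n _ _ _ _ M0 B0 rho0 e0.
exists r, (Num.min e d); split; first by rewrite lt_min e0.
move=> G G' y y' tG tG' yW y'W; rewrite le_min => /andP[yy' _] GG' j.
have {}GG' p : enorm p <= r -> `|G p - G' p| <= d.
  by move/GG'; rewrite le_min => /andP[].
have EE' := Hd G G' tG' GG'.
have GG'C p : enorm p <= r -> `|G' p - G p| <= d by rewrite distrC; exact: GG'.
have E'E := Hd G' G tG GG'C.
have dist_bound (F : 'rV[R]_n -> R) u : tame M B F -> enorm u <= W ->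
    conj_epi F !=set0 /\ edist u (conj_epi F) <= D.
  move=> tF uW; have [w Ew wM] := conj_epi_bounded_point M0 tF.
  split; first by exists w.
  apply: (le_trans (edist_le u Ew)); apply: (le_trans (ler_enormB u w)).
  exact: lerD.
have [E0 dE] := dist_bound G y tG yW; have [E'0 dE'] := dist_bound G' y' tG' y'W.
have cl (F : 'rV[R]_n -> R) : adherence_closed (conj_epi F) :=
  @adherence_closed_conj_epi _ _ F.
have cv (F : 'rV[R]_n -> R) : segment_closed (conj_epi F) :=
  @segment_closed_conj_epi _ _ F.
apply: (@le_trans _ _ ((n + 1)%:R * (45 * e * S))); last first.
  have -> : (n + 1)%:R * (45 * e * S) = e * (45 * ((n + 1)%:R * S)) by ring.
  by apply: le_trans eeps; rewrite !ler_pM2l// lerDl.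
have -> : 45 * e = 15 * (e + 2 * e) by ring.
have weaken (K K' : set 'rV[R]_(n + 1)) k : k <= e ->
    (forall z, K z -> exists2 z', K' z' & enorm (z - z') <= 15 * (k + 2 * e)) ->
    forall z, K z -> exists2 z', K' z' & enorm (z - z') <= 15 * (e + 2 * e).
  move=> ke KK' z /KK'[z' K'z' zz']; exists z' => //; apply: le_trans zz' _.
  by rewrite ler_wpM2l// lerD2r.
apply: (@steiner_close _ _ (W + 2 * D)).
- exact: near_part_neq0.
- exact: near_part_neq0.
- exact: near_part_bounded.
- exact: near_part_bounded.
- apply: (weaken _ _ _ yy'); apply: near_part_within EE' E'E _ _ => //.
  + by rewrite /rho; lra.
  + by rewrite /rho; lra.
- rewrite enormBC in yy'.
  apply: (weaken _ _ _ yy'); apply: near_part_within E'E EE' _ _ => //.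
  + by rewrite /rho; lra.
  + by rewrite /rho; lra.
Qed.

End stability.

(** * Convergence of canonical pairs *)

Lemma epi_lagrangianE (R : realType) (n : nat)
  (H : R -> 'rV[R]_n -> 'rV[R]_n -> R) t x :
  epi_lagrangian H t x = conj_epi (H t x).
Proof.
apply/seteqP; split => z /= Ez.
- move=> p; rewrite -lee_fin; apply: le_trans Ez.
  by apply: ereal_sup_ubound; exists p.
- by apply: ge_ereal_sup => _ [p _ <-]; rewrite lee_fin.
Qed.

(** The Lipschitz condition in [p], taken between [0] and [p], is the linear lower bound, with slope
    [c t * (1 + enorm x)]. *)
Lemma admissible_tame (R : realType) (n : nat)
    (H : R -> 'rV[R]_n -> 'rV[R]_n -> R) c lam (T t M B : R) x :
  admissible H c lam T -> 0 <= t <= T ->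
  c t * (1 + enorm x) <= M -> `|H t x 0| <= B -> tame M B (H t x).
Proof.
move=> adm tT cM HB; split => //.
- move=> s p q s01.
  have s'01 : 0 <= 1 - s <= 1 by case/andP: s01 => *; apply/andP; split; lra.
  have /andP[s'0 s'1] := s'01.
  have := adm_H_convex adm x tT (Itv01 s'0 s'1) (x := p) (y := q)
    (mem_set I) (mem_set I).
  by rewrite [leRHS]convRE /conv/= /unstable.onem subKr.
- by apply: lipschitz_continuous => p q; exact: (adm_H_lip_p adm x p q tT).
- move=> p; have := adm_H_lip_p adm x 0 p tT; rewrite sub0r enormN.
  rewrite ler_norml => /andP[_ h].
  have : c t * (1 + enorm x) * enorm p <= M * enorm p.
    by rewrite ler_wpM2r ?enorm_ge0.
  lra.
Qed.

(** * Uniform convergence on compact sets *)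

Section uniform_convergence.
Context {R : realType} {U : topologicalType} {V : pseudoMetricNormedZmodType R}.

Lemma cvg_uniform_on_compactsP (D : set U) (g_ : nat -> U -> V) (g : U -> V) :
  cvg_uniform_on_compacts D g_ g <->
  forall K, compact K -> K `<=` D -> forall e : R, 0 < e ->
    \forall i \near \oo, forall x, K x -> `|g x - g_ i x| < e.
Proof.
split.
- move=> /fam_cvgP gc K cK KD e e0.
  have : nbhs (g : {uniform` K -> V})
      [set h | forall x, K x -> `|g x - h x| < e].
    apply/uniform_nbhs; exists [set xy | `|xy.1 - xy.2| < e]; split => //.
    by rewrite -entourage_from_ballE; exists e => // -[u v] /=; rewrite -ball_normE.
  exact: (gc K (conj cK KD)).
- move=> gc; apply/fam_cvgP => K [cK KD] P /uniform_nbhs[E [entE EP]].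
  move: entE; rewrite -entourage_from_ballE => -[e /= e0 eE].
  apply: filterS (gc K cK KD e e0) => i gi; apply: EP => x Kx /=.
  by apply: eE; rewrite /= -ball_normE; exact: gi.
Qed.

End uniform_convergence.

Lemma compact_continuous_bounded (R : realType) (U : topologicalType)
    (f : U -> R) (K : set U) : compact K -> continuous f ->
  exists2 B : R, 0 <= B & forall x, K x -> `|f x| <= B.
Proof.
move=> cK cf.
have /ex_strict_bound_gt0[B B0 fB] : bounded_set (f @` K).
  by apply/compact_bounded/continuous_compact => //; exact: continuous_subspaceT.
exists B; first exact: ltW.
by move=> x Kx; rewrite ltW//; apply: fB; exists x.
Qed.

Lemma canonical_e_near_part (R : realType) (n : nat)
    (H : R -> 'rV[R]_n -> 'rV[R]_n -> R) c lam t x a :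
  canonical_e H c lam t x a =
  steiner (near_part (conj_epi (H t x)) (omega H c lam t x *: a)).
Proof. by rewrite /canonical_e /Phi epi_lagrangianE. Qed.

(** For [(x, a)] in [K] and large [i], the functions [H t x] and [H_ i t x] are tame with common
    constants and their centres are bounded by a common [W], so one pair of stability thresholds
    serves all. *)
Lemma canonical_e_cvg (R : realType) (n : nat) (T : R)
  (H_ : nat -> R -> 'rV[R]_n -> 'rV[R]_n -> R) (c_ : nat -> R -> R)
  (lam_ : nat -> R -> 'rV[R]_n -> R)
  (H : R -> 'rV[R]_n -> 'rV[R]_n -> R) (c : R -> R) (lam : R -> 'rV[R]_n -> R)
  (t : R) (K : set ('rV[R]_n * 'rV[R]_(n + 1))) (eps : R) :
  (forall i, admissible (H_ i) (c_ i) (lam_ i) T) -> admissible H c lam T ->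
  0 <= t <= T ->
  cvg_uniform_on_compacts setT
    (fun i (xp : 'rV[R]_n * 'rV[R]_n) => H_ i t xp.1 xp.2)
    (fun xp => H t xp.1 xp.2) ->
  cvg_uniform_on_compacts setT (fun i => lam_ i t) (lam t) ->
  c_ i t @[i --> \oo] --> c t ->
  compact K -> K `<=` setT `*` eball 0 1 -> 0 < eps ->
  \forall i \near \oo, forall xa, K xa -> forall j,
    `|canonical_e H c lam t xa.1 xa.2 0 j -
      canonical_e (H_ i) (c_ i) (lam_ i) t xa.1 xa.2 0 j| <= eps.
Proof.
move=> adm_i adm tT /cvg_uniform_on_compactsP cH /cvg_uniform_on_compactsP cl cc.
move=> cK K1 eps0.
pose X := fst @` K.
have cX : compact X.
  by apply: continuous_compact cK;
    apply: continuous_subspaceT => -[x a]; exact: cvg_fst.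
have [N N0 XN] := compact_continuous_bounded cX (@continuous_enorm R n).
have [L L0 XL] := compact_continuous_bounded cX (adm_lam_continuous adm tT).
have cX0 : compact (X `*` [set (0 : 'rV[R]_n)]).
  by apply: compact_setX => //; exact: compact_set1.
have [B' B'0 XB'] := compact_continuous_bounded cX0 (adm_H_continuous adm tT).
have c0 : 0 <= c t := adm_c_ge0 adm tT.
(* The added units absorb the passage from the limit to index [i], where [c], [lam] and [H] at
   [p = 0] move by less than 1. [W] bounds [omega], hence the centres, as [|a| <= 1]. *)
pose M := (c t + 1) * (1 + N); pose B := B' + 1; pose W := L + 1 + B + M + 1.
have M0 : 0 <= M by rewrite mulr_ge0 ?addr_ge0.
have B0 : 0 <= B by rewrite addr_ge0.
have W0 : 0 <= W by rewrite !addr_ge0.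
have [r [d [d0 stable]]] := @steiner_near_part_stable R n _ _ _ _ M0 B0 W0 eps0.
(* [omega] moves by at most [e] through [lam], [e] through [H] at [p = 0], and [e (1 + N)] through
   [c]. *)
pose e := Num.min 1 (d / (3 + N)).
have N3 : 0 < 3 + N by rewrite ltr_wpDr.
have e0 : 0 < e by rewrite lt_min ltr01 divr_gt0.
have e1 : e <= 1 by rewrite ge_min lexx.
have ed : e * (3 + N) <= d by rewrite -ler_pdivlMr// ge_min lexx orbT.
(* The maximum with 0 keeps [p = 0] in the ball whatever the sign of [r]. *)
have cXr : compact (X `*` eball (0 : 'rV[R]_n) (Num.max 0 r)).
  by apply: compact_setX => //; exact: compact_eball.
have near_lam := cl X cX (fun _ _ => I) e e0.
have near_H := cH _ cXr (fun _ _ => I) e e0.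
have near_c : \forall i \near \oo, `|c t - c_ i t| < e by move/cvgrPdist_lt : cc; apply.
near=> i.
have lam_e : forall x, X x -> `|lam t x - lam_ i t x| < e by near: i.
have H_e : forall xp, (X `*` eball (0 : 'rV[R]_n) (Num.max 0 r)) xp ->
  `|H t xp.1 xp.2 - H_ i t xp.1 xp.2| < e by near: i.
have c_e : `|c t - c_ i t| < e by near: i.
have ci0 := adm_c_ge0 (adm_i i) tT.
move=> [x a] Kxa j /=.
have Xx : X x by exists (x, a).
have a1 : enorm a <= 1 by rewrite -eball0E; have [] := K1 _ Kxa.
have xN : enorm x <= N by have := XN _ Xx; rewrite ger0_norm ?enorm_ge0.
have x0 := enorm_ge0 x.
have xL := XL _ Xx.
have xB : `|H t x 0| <= B' := XB' (x, 0) (conj Xx erefl).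
have cHp p : enorm p <= r -> `|H t x p - H_ i t x p| < e.
  move=> pr; apply: (H_e (x, p)); split => //=.
  by rewrite eball0E le_max pr orbT.
have cH0 : `|H t x 0 - H_ i t x 0| < e.
  apply: (H_e (x, 0)); split => //=.
  by rewrite eball0E enorm0 le_max lexx.
have clx := lam_e _ Xx.
have xBi : `|H_ i t x 0| <= B.
  have := ler_normB (H t x 0) (H t x 0 - H_ i t x 0); rewrite subKr /B; lra.
have xLi : `|lam_ i t x| <= L + 1.
  have := ler_normB (lam t x) (lam t x - lam_ i t x); rewrite subKr; lra.
have ci1 : c_ i t <= c t + 1 by move: c_e; rewrite ltr_norml => /andP[? ?]; lra.
have cM : c t * (1 + enorm x) <= M.
  by rewrite ler_pM ?addr_ge0 ?lerD2l ?lerDl.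
have cMi : c_ i t * (1 + enorm x) <= M.
  by rewrite ler_pM ?addr_ge0 ?lerD2l.
rewrite !canonical_e_near_part.
have omega_bound (h g l : R) : `|h| <= B -> `|l| <= L + 1 -> 0 <= g <= M ->
    enorm ((`|l| + `|h| + g + 1) *: a) <= W.
  move=> hB lL /andP[g0 gM].
  rewrite enormZ ger0_norm; last by rewrite !addr_ge0.
  rewrite -[leRHS]mulr1; apply: ler_pM; rewrite ?enorm_ge0 ?addr_ge0//.
  by rewrite /W; lra.
apply: stable.
- by apply: (admissible_tame adm tT cM); rewrite /B; lra.
- exact: (admissible_tame (adm_i i) tT cMi).
- apply: omega_bound; [rewrite /B; lra|lra|].
  by rewrite cM mulr_ge0// addr_ge0.
- by apply: omega_bound => //; rewrite cMi mulr_ge0// addr_ge0.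
- rewrite -scalerBl enormZ; apply: (@le_trans _ _ (e * (3 + N) * 1)); last first.
    by rewrite mulr1.
  apply: ler_pM => //; first exact: enorm_ge0.
  rewrite /omega.
  have hc : `|(c t - c_ i t) * (1 + enorm x)| <= e * (1 + N).
    rewrite normrM; apply: ler_pM => //; first exact: ltW.
    by rewrite ger0_norm; lra.
  have hl := ler_dist_dist (lam t x) (lam_ i t x).
  have hh := ler_dist_dist (H t x 0) (H_ i t x 0).
  have -> : `|lam t x| + `|H t x 0| + c t * (1 + enorm x) + 1 -
      (`|lam_ i t x| + `|H_ i t x 0| + c_ i t * (1 + enorm x) + 1) =
    (`|lam t x| - `|lam_ i t x|) + (`|H t x 0| - `|H_ i t x 0|) +
    (c t - c_ i t) * (1 + enorm x) by ring.
  apply: le_trans (ler_normD _ _) _; apply: le_trans (lerD (ler_normD _ _) hc) _.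
  lra.
- move=> p pr; apply: ltW; apply: lt_le_trans (cHp p pr) _.
  apply: le_trans ed; rewrite ler_peMr; lra.
Unshelve. all: by end_near. Qed.

Unset Implicit Arguments.

Theorem theorem3p9 (R : realType) (n : nat) (T : R)
  (H_ : nat -> R -> 'rV[R]_n -> 'rV[R]_n -> R) (c_ : nat -> R -> R)
  (lam_ : nat -> R -> 'rV[R]_n -> R)
  (H : R -> 'rV[R]_n -> 'rV[R]_n -> R) (c : R -> R) (lam : R -> 'rV[R]_n -> R)
  (n_ge1 : (1 <= n)%N) (T_gt0 : 0 < T)
  (adm_i : forall i, admissible (H_ i) (c_ i) (lam_ i) T)
  (adm : admissible H c lam T)
  (cvg_H : forall t : R, 0 <= t <= T ->
    cvg_uniform_on_compacts setT
      (fun i (xp : 'rV[R]_n * 'rV[R]_n) => H_ i t xp.1 xp.2)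
      (fun xp => H t xp.1 xp.2))
  (cvg_lam : forall t : R, 0 <= t <= T ->
    cvg_uniform_on_compacts setT (fun i => lam_ i t) (lam t))
  (cvg_c : forall t : R, 0 <= t <= T -> c_ i t @[i --> \oo] --> c t) :
  forall t : R, 0 <= t <= T ->
    cvg_uniform_on_compacts (setT `*` eball 0 1)
      (fun i (xa : 'rV[R]_n * 'rV[R]_(n + 1)) =>
        canonical_f (H_ i) (c_ i) (lam_ i) t xa.1 xa.2)
      (fun xa => canonical_f H c lam t xa.1 xa.2) /\
    cvg_uniform_on_compacts (setT `*` eball 0 1)
      (fun i (xa : 'rV[R]_n * 'rV[R]_(n + 1)) =>
        canonical_l (H_ i) (c_ i) (lam_ i) t xa.1 xa.2)
      (fun xa => canonical_l H c lam t xa.1 xa.2).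
Proof.
move=> t tT.
have cvg_e K : compact K -> K `<=` setT `*` eball 0 1 -> forall e : R, 0 < e ->
    \forall i \near \oo, forall xa, K xa -> forall j,
      `|canonical_e H c lam t xa.1 xa.2 0 j -
        canonical_e (H_ i) (c_ i) (lam_ i) t xa.1 xa.2 0 j| <= e / 2.
  move=> cK K1 e e0.
  apply: (canonical_e_cvg adm_i adm tT (cvg_H t tT) (cvg_lam t tT) (cvg_c t tT)) => //.
  exact: divr_gt0.
have half_lt (e : R) : 0 < e -> e / 2 < e by move=> ?; lra.
split; apply/cvg_uniform_on_compactsP => K cK K1 e e0.
- apply: filterS (cvg_e K cK K1 e e0) => i Ki xa Kxa.
  apply: le_lt_trans (half_lt e e0).
  (* The uniform structure is that of the sup norm, so the coordinatewise bounds [e / 2] suffice. *)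
  rewrite [leLHS]/Num.norm /= mx_normrE; apply: bigmax_le.
    by rewrite divr_ge0// ltW.
  move=> [k j] _ /=; have := Ki xa Kxa (lshift 1 j); rewrite ord1 /canonical_f.
  by move: (canonical_e _ _ _ _ _ _) (canonical_e _ _ _ _ _ _) => u v; rewrite !mxE.
- apply: filterS (cvg_e K cK K1 e e0) => i Ki xa Kxa.
  apply: le_lt_trans (half_lt e e0).
  have := Ki xa Kxa (rshift n 0); rewrite /canonical_l.
  by move: (canonical_e _ _ _ _ _ _) (canonical_e _ _ _ _ _ _) => u v; rewrite !mxE.
Qed.
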